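(* Let $\hat L$ be a finite atomic lattice. Let $I\subset k[\mathbf{y}]:=k[y_1,\ldots,y_n]$ be any squarefree monomial ideal with $LCM(I)\cong\hat L$, and let $M=M(L)\subset k[L]$ be the squarefree minimal ideal of $\hat L$. (i) $n\ge \#\operatorname{mi}(L)$. (ii) There exists an injective $k$-algebra homomorphism $\phi:k[L]\to k[\mathbf{y}]$ sending variables to variables that satisfies $I\subset \phi(M)\cdot k[\mathbf{y}]$. If $n=\#\operatorname{mi}(L)$, then $\phi$ is an isomorphism. (iii) Embed $LCM(I)\hookrightarrow 2^{n}$ and $\hat L=LCM(M)\hookrightarrow 2^{\#\operatorname{mi}(L)}$ by identifying a squarefree monomial with its support (set of variables dividing it), where $2^{n}$ and $2^{\#\operatorname{mi}(L)}$ are the Boolean lattices of subsets of the respective sets of variables. Then there exists a join-preserving injection $\rho:2^{\#\operatorname{mi}(L)}\to 2^{n}$ such that $\rho(\hat L)=LCM(I)$.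
   Context: Fix a field $k$. A finite atomic lattice $\hat L$ is a finite lattice with minimum $\hat 0$ and maximum $\hat 1$ in which every element is a join of atoms. Its proper part is $L=\hat L\setminus\{\hat 0,\hat 1\}$. $\operatorname{mi}(L)$ denotes the set of meet-irreducible elements of $L$, i.e. elements of $L$ covered by exactly one element of $\hat L$. Put $k[L]:=k[x_l : l\in\operatorname{mi}(L)]$. For $a\in\hat L$, $x(a):=\prod_{l} x_l$, the product over all $l\in \operatorname{mi}(L)$ with $a\not\le l$. The squarefree minimal ideal of $\hat L$ is $M(L):=(x(a): a \text{ an atom of }\hat L)\subset k[L]$; $\hat L$ is identified with $LCM(M(L))$ via $a\mapsto x(a)$. For a monomial ideal $I$ with minimal monomial generators $f_1,\ldots,f_r$, the lcm-lattice $LCM(I)$ is the set of least common multiples of all subsets of $\{f_1,\ldots,f_r\}$ (the empty subset giving $1$), ordered by divisibility.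
   Formalization: Part (ii) is stated for I different from (1) (automatic unless the lattice has one element, where M=0 and the inclusion fails); part (iii) is stated for lattices not having exactly two elements, where mi(L) is empty, LCM(M)={1}, and the claim fails. *)

(* Defs.v *)
From HB Require Import structures.
From mathcomp Require Import all_boot all_order all_algebra.
From mathcomp Require Import mpoly.

Set Implicit Arguments.
Unset Strict Implicit.
Unset Printing Implicit Defensive.

Import Order.TTheory GRing.Theory.
Local Open Scope ring_scope.

Section Lattice.
Variables (d : Order.disp_t) (L : finTBLatticeType d).

(* [covers x y]: y covers x. *)
Definition covers (x y : L) : bool :=
  (x < y)%O && [forall z : L, ~~ ((x < z)%O && (z < y)%O)].

Definition atom (a : L) : bool := covers \bot%O a.

Definition atomic : Prop :=
  forall a : L, exists A : {set L},
    (forall b, b \in A -> atom b) /\ a = (\join_(b in A) b)%O.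

(* [L] is the whole lattice, so that the meet-irreducibles of its proper part
   have to avoid the minimum and the maximum explicitly. *)
Definition mi : {set L} :=
  [set l : L | [&& l != \bot%O, l != \top%O
                 & #|[set u : L | covers l u]| == 1%N]].

End Lattice.

Arguments atomic {d} L.
Arguments mi {d} L.

(* Ideals are [Prop]-valued predicates: membership in an arbitrary ideal is not
   decidable, and the ideals of ring_quotient are proper by definition. *)
Definition ideal_gen (R : comNzRingType) (G : R -> Prop) (p : R) : Prop :=
  exists s : seq (R * R),
    (forall c, c \in s -> G c.2) /\ p = \sum_(c <- s) c.1 * c.2.

(* In the rest of this file a monomial 'X_[m] is represented by its exponent
   vector m : 'X_{1..n}; (m1 <= m2)%MM is divisibility. *)
Definition squarefree (n : nat) (m : 'X_{1..n}) : Prop :=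
  forall i : 'I_n, (m i <= 1)%N.

Definition mnm_support (n : nat) (m : 'X_{1..n}) : {set 'I_n} :=
  [set i : 'I_n | m i != 0%N].

Section MonomialIdeals.
Variables (k : fieldType) (n : nat).
Implicit Type I : {mpoly k[n]} -> Prop.

Definition squarefree_monomial_ideal I : Prop :=
  exists G : 'X_{1..n} -> Prop,
    (forall m, G m -> squarefree m) /\
    (forall p, I p <-> ideal_gen (fun q => exists2 m, G m & q = 'X_[m]) p).

(* The minimal monomial generators of a monomial ideal are its
   divisibility-minimal monomials. *)
Definition min_generator I (m : 'X_{1..n}) : Prop :=
  I 'X_[m] /\ (forall m' : 'X_{1..n}, I 'X_[m'] -> (m' <= m)%MM -> m' = m).

Definition LCM I (m : 'X_{1..n}) : Prop :=
  exists s : seq 'X_{1..n},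
    (forall f, f \in s -> min_generator I f) /\
    m = \big[@mlcm n/0%MM]_(f <- s) f.

(* An order isomorphism, hence a lattice isomorphism, from [L] onto [LCM I]. *)
Definition LCM_iso (d : Order.disp_t) (L : finTBLatticeType d) I : Prop :=
  exists f : L -> 'X_{1..n},
    (forall a b : L, (f a <= f b)%MM = (a <= b)%O) /\
    (forall m, LCM I m <-> exists a, f a = m).

End MonomialIdeals.

Section MinimalIdeal.
Variables (k : fieldType) (d : Order.disp_t) (L : finTBLatticeType d).

(* k[L] is {mpoly k[#|mi L|]}, the variable x_l being 'X_i for the index i with
   enum_val i = l. *)
Definition xmon (a : L) : {mpoly k[#|mi L|]} :=
  \prod_(i < #|mi L| | ~~ (a <= enum_val i)%O) 'X_i.

Definition minimal_ideal : {mpoly k[#|mi L|]} -> Prop :=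
  ideal_gen (fun q => exists2 a : L, atom a & q = xmon a).

End MinimalIdeal.

(* Main.v *)
Require Import Defs.
From HB Require Import structures.
From mathcomp Require Import all_boot all_order all_algebra.
From mathcomp Require Import mpoly.
From Stdlib Require Import Classical.

Set Implicit Arguments.
Unset Strict Implicit.
Unset Printing Implicit Defensive.

Import Order.TTheory GRing.Theory.
Local Open Scope ring_scope.

(** Let f : L -> 'X_{1..n} be the isomorphism onto LCM(I). It turns joins into
    lcms, so for each variable y_j there is a largest element mu(j) of L whose
    image is not divisible by y_j, and y_j divides f(a) iff a is not below mu(j).
    A meet-irreducible l with unique cover u is a value of mu: any variable
    dividing f(u) but not f(l) is labelled by l, since everything strictly above
    l is above u. Choosing j(l) with mu(j(l)) = l embeds mi(L) in the set of
    variables, and x_l |-> y_j(l) sends x(b) to a divisor of f(b) for every b.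
    For the last part, a variable y_j divides f(a) iff some meet-irreducible
    l >= mu(j) is not above a, which expresses the support of f(a) as a union
    over the support of x(a). *)

(** * Generated ideals, monomial membership and minimal generators *)

Lemma ideal_gen0 (R : comNzRingType) (G : R -> Prop) : ideal_gen G 0.
Proof. by exists [::]; rewrite big_nil. Qed.

Lemma ideal_genD (R : comNzRingType) (G : R -> Prop) p q :
  ideal_gen G p -> ideal_gen G q -> ideal_gen G (p + q).
Proof.
move=> [s [Gs ->]] [t [Gt ->]]; exists (s ++ t); rewrite big_cat; split=> // c.
by rewrite mem_cat => /orP[/Gs|/Gt].
Qed.

Lemma ideal_genMl (R : comNzRingType) (G : R -> Prop) r p :
  ideal_gen G p -> ideal_gen G (r * p).
Proof.
move=> [s [Gs ->]]; exists [seq (r * c.1, c.2) | c <- s]; split.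
  by move=> c /mapP[c' /Gs Gc' ->].
by rewrite big_map mulr_sumr; apply: eq_bigr => c _; rewrite mulrA.
Qed.

Lemma mem_ideal_gen (R : comNzRingType) (G : R -> Prop) p :
  G p -> ideal_gen G p.
Proof.
move=> Gp; exists [:: (1, p)]; rewrite big_seq1 mul1r; split=> // c.
by rewrite inE => /eqP ->.
Qed.

Lemma ideal_gen_sub (R : comNzRingType) (G H : R -> Prop) p :
  (forall q, G q -> ideal_gen H q) -> ideal_gen G p -> ideal_gen H p.
Proof.
move=> GH [s [Gs ->]]; rewrite big_seq.
apply: big_ind => [|q r|c /Gs Gc].
- exact: ideal_gen0.
- exact: ideal_genD.
- exact/ideal_genMl/GH.
Qed.

(** If 'X_[m] is a combination of generators, its coefficient 1 at [m] must come from some summand,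
    and the support of a multiple of 'X_[g] contains only multiples of [g]. *)
Lemma ideal_gen_mpolyX (k : fieldType) (n : nat) (G : 'X_{1..n} -> Prop) m :
  ideal_gen (fun q : {mpoly k[n]} => exists2 g, G g & q = 'X_[g]) 'X_[m] <->
  exists2 g, G g & (g <= m)%MM.
Proof.
split=> [[s [Gs Xm]]|[g Gg le_gm]]; last first.
  rewrite -(submK le_gm) mpolyXD; apply/ideal_genMl/mem_ideal_gen.
  by exists g.
have /hasP[c sc mc] : has (fun c : {mpoly k[n]} * {mpoly k[n]} =>
    m \in msupp (c.1 * c.2)) s.
  apply/negPn/negP => /hasPn s0; have := mcoeffX k m m.
  rewrite Xm eqxx raddf_sum big1_seq => [/eqP|c /andP[_ /s0 /memN_msupp_eq0 //]].
  by rewrite eq_sym oner_eq0.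
have [g Gg cE] := Gs c sc; exists g => //; move: mc.
rewrite cE (perm_mem (msuppMX _ _)) => /mapP[m' _ ->]; exact: lem_addr.
Qed.

(** Strong induction on the degree: a monomial that is not minimal has a proper divisor in [I], of
    smaller degree. *)
Lemma min_generator_le (k : fieldType) (n : nat) (I : {mpoly k[n]} -> Prop) m :
  I 'X_[m] -> exists2 g, min_generator I g & (g <= m)%MM.
Proof.
have [N] := ubnP (mdeg m); elim: N m => // N IH m ltmN Im.
have [min_m|nmin] := classic (min_generator I m).
  by exists m; rewrite ?lepm_refl.
have [m' Im' [le_m'm neq]] :
    exists2 m', I 'X_[m'] & (m' <= m)%MM /\ m' <> m.
  apply: NNPP => no; apply: nmin; split=> // m' Im' lem; apply: NNPP => neq.
  by apply: no; exists m'.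
have [|g gmin le_gm'] := IH m' _ Im'.
  apply: (@leq_trans (mdeg m)) => //.
  rewrite -[X in (_ < mdeg X)%N](submK le_m'm) mdegD.
  rewrite -[X in (X < _)%N]add0n ltn_add2r lt0n mdeg_eq0.
  apply/eqP => sub0; apply: neq; by rewrite -(submK le_m'm) sub0 add0m.
by exists g => //; apply: lepm_trans le_m'm.
Qed.

Lemma min_generator_of_gens (k : fieldType) (n : nat) (I : {mpoly k[n]} -> Prop)
    (G : 'X_{1..n} -> Prop) m :
  (forall p, I p <-> ideal_gen (fun q => exists2 g, G g & q = 'X_[g]) p) ->
  min_generator I m -> G m.
Proof.
move=> IG [/IG /ideal_gen_mpolyX[g Gg le_gm] min_m].
by rewrite -(min_m g) //; apply/IG/ideal_gen_mpolyX; exists g; rewrite ?lepm_refl.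
Qed.

(** * Closure properties of lcm-lattices *)

Lemma LCM0 (k : fieldType) (n : nat) (I : {mpoly k[n]} -> Prop) : LCM I 0%MM.
Proof. by exists [::]; rewrite big_nil. Qed.

Lemma LCM_mlcm (k : fieldType) (n : nat) (I : {mpoly k[n]} -> Prop) m1 m2 :
  LCM I m1 -> LCM I m2 -> LCM I (mlcm m1 m2).
Proof.
move=> [s [Is ->]] [t [It ->]]; exists (s ++ t); split=> [g|].
  by rewrite mem_cat => /orP[/Is|/It].
elim: s {Is} => [|g s IHs]; first by rewrite big_nil mlc0m.
rewrite /= !big_cons -IHs; apply/mnmP=> i; by rewrite !mnmE maxnA.
Qed.

Lemma LCM_squarefree (k : fieldType) (n : nat) (I : {mpoly k[n]} -> Prop) m :
  squarefree_monomial_ideal I -> LCM I m -> squarefree m.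
Proof.
move=> [G [sqG IG]] [s [Is ->]]; rewrite big_seq.
apply: big_ind => [i|m1 m2 sq1 sq2 i|g /Is /(min_generator_of_gens IG) /sqG//].
  by rewrite mnm0E.
by rewrite mnmE geq_max sq1 sq2.
Qed.

(** * Meet-irreducibles separate elements *)

Lemma maximal_not_above (d : Order.disp_t) (L : finTBLatticeType d) (a b : L) :
  ~~ (a <= b)%O -> exists2 l : L, (b <= l)%O && ~~ (a <= l)%O &
    forall z, (l < z)%O -> (a <= z)%O.
Proof.
move=> nab.
have P0 : (b <= b)%O && ~~ (a <= b)%O by rewrite lexx.
(* A maximal such [l] is found by minimizing the number of upper bounds, which strictly drops when
   moving up. *)
case: (arg_minnP (P := fun l => (b <= l)%O && ~~ (a <= l)%O)
  (fun l : L => #|[set z | (l <= z)%O]|) P0) => l Pl lmin.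
exists l => // z lt_lz; apply/negPn/negP => naz.
have /andP[le_bl _] := Pl.
have := lmin z; rewrite naz (le_trans le_bl (ltW lt_lz)) => /(_ isT).
apply/negP; rewrite -ltnNge; apply: proper_card; apply/properP; split.
  by apply/subsetP => x; rewrite !inE; apply/le_trans/ltW.
by exists l; rewrite !inE ?lexx // lt_geF.
Qed.

(* Without [#|L| != 2] the bottom element can be meet-irreducible, which [mi]
   excludes. *)
Lemma mi_separates (d : Order.disp_t) (L : finTBLatticeType d) (a b : L) :
  atomic L -> #|L| != 2%N -> ~~ (a <= b)%O ->
  exists2 l, l \in mi L & (b <= l)%O && ~~ (a <= l)%O.
Proof.
move=> hL hL2 /maximal_not_above[l Pl lmax]; exists l => //.
have /andP[_ nal] := Pl.
rewrite inE; apply/and3P; split.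
(* If [l] were the bottom, every nonzero element would be above [a], so [a] would be the only atom
   and atomicity would leave just the bottom and [a]. *)
- apply: contra hL2 => /eqP l0; rewrite {}l0 {Pl} in lmax nal.
  have atom_eq c : atom c -> c = a.
    move=> /andP[lt0c /forallP/(_ a)]; rewrite lt0x -lex0 nal /= => nac.
    have := lmax _ lt0c; rewrite le_eqVlt (negPf nac) orbF; by move/eqP.
  suff -> : #|L| = #|[set \bot%O; a]|.
    by rewrite cards2 [_ == a]eq_sym -lex0 nal.
  apply: eq_card => z; rewrite !inE; have [A [Aat ->]] := hL z.
  apply/esym; apply: (big_ind (fun z => (z == \bot%O) || (z == a))).
  + by rewrite eqxx.
  + by move=> x y /orP[]/eqP-> /orP[]/eqP->;
      rewrite ?joinxx ?join0x ?joinx0 ?eqxx ?orbT.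
  + by move=> c /Aat/atom_eq ->; rewrite eqxx orbT.
- by apply: contra nal => /eqP ->; rewrite lex1.
(* Anything strictly above [l] is above [a], hence above the join: this join is the unique cover. *)
- apply/cards1P; exists (l `|` a)%O; apply/setP => u; rewrite !inE.
  have lt_lJ : (l < l `|` a)%O.
    by rewrite lt_def leUl andbT; apply: contra nal => /eqP <-; rewrite leUr.
  apply/idP/eqP => [/andP[lt_lu /forallP/(_ (l `|` a)%O)]|->].
    rewrite lt_lJ /= => nlt.
    have : (l `|` a <= u)%O by rewrite leUx (ltW lt_lu) lmax.
    by rewrite le_eqVlt (negPf nlt) orbF => /eqP.
  rewrite /covers lt_lJ; apply/forallP => z; apply/negP => /andP[lt_lz].
  by apply/negP; rewrite le_gtF // leUx (ltW lt_lz) lmax.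
Qed.

(** * Labelling variables by lattice elements *)

Section JoinEmbedding.
Variables (d : Order.disp_t) (L : finTBLatticeType d) (n : nat).
Variable f : L -> 'X_{1..n}.
Hypothesis f_le : forall a b, (f a <= f b)%MM = (a <= b)%O.
Hypothesis f0 : f \bot%O = 0%MM.
Hypothesis fU : forall a b, f (a `|` b)%O = mlcm (f a) (f b).

Definition last_missing (j : 'I_n) : L := (\join_(a | f a j == 0%N) a)%O.

(** Since [f] turns joins into lcms, the join of all elements whose image omits y_j still has an
    image omitting y_j. *)
Lemma le_last_missing a j : (a <= last_missing j)%O = (f a j == 0%N).
Proof.
apply/idP/idP => [le_a|fa0]; last exact: joins_sup.
have : f (last_missing j) j == 0%N.
  apply: (big_ind (fun a => f a j == 0%N)) => // [|x y].
    by rewrite f0 mnm0E.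
  by rewrite fU mnmE => /eqP-> /eqP->.
by rewrite -!leqn0; apply: leq_trans; move: le_a; rewrite -f_le => /mnm_lepP.
Qed.

Lemma mi_last_missing l : (forall a, squarefree (f a)) -> l \in mi L ->
  exists j, last_missing j = l.
Proof.
move=> sqf; rewrite inE => /and3P[_ _ /cards1P[u covl]].
(* A minimal element of the interval from [l] (excluded) to [z] covers [l], so it is [u]. *)
have lu z : (l < z)%O -> (u <= z)%O.
  move=> lt_lz.
  case: (arg_minnP (P := fun y => (l < y)%O && (y <= z)%O)
    (fun y : L => #|[set t | (t <= y)%O]|) (i0 := z))
    => [|y /andP[lt_ly le_yz] ymin].
    by rewrite lt_lz lexx.
  suff : y \in [set u0 | covers l u0] by rewrite covl inE => /eqP <-.
  rewrite inE /covers lt_ly; apply/forallP => t; apply/negP => /andP[lt_lt lt_ty].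
  have := ymin t; rewrite lt_lt (le_trans (ltW lt_ty) le_yz) => /(_ isT).
  apply/negP; rewrite -ltnNge; apply: proper_card; apply/properP; split.
    by apply/subsetP => x; rewrite !inE => /le_trans->//; apply: ltW.
  by exists y; rewrite !inE ?lexx // lt_geF.
have /andP[lt_lu _] : covers l u.
  have : u \in [set u0 | covers l u0] by rewrite covl inE.
  by rewrite inE.
have : ~~ (f u <= f l)%MM by rewrite f_le lt_geF.
move=> /forallPn[j]; rewrite -ltnNge => ltj; exists j.
(* Squarefreeness enters here: an exponent strictly below another that is at most 1 is 0. *)
have fl0 : f l j == 0%N by rewrite -leqn0 -ltnS; apply: leq_trans ltj (sqf u j).
have nu : ~~ (u <= last_missing j)%O.
  by rewrite le_last_missing -lt0n (leq_ltn_trans _ ltj).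
move: fl0; rewrite -le_last_missing le_eqVlt => /orP[/eqP->//|/lu].
by rewrite (negPf nu).
Qed.

End JoinEmbedding.

Lemma LCM_iso_bot (k : fieldType) (d : Order.disp_t) (L : finTBLatticeType d)
    (n : nat) (I : {mpoly k[n]} -> Prop) (f : L -> 'X_{1..n}) :
  (forall a b, (f a <= f b)%MM = (a <= b)%O) ->
  (forall m, LCM I m <-> exists a, f a = m) -> f \bot%O = 0%MM.
Proof.
move=> f_le f_im; have [a fa0] := (f_im _).1 (LCM0 I).
have /mnm_lepP f0 : (f \bot%O <= 0)%MM by rewrite -fa0 f_le le0x.
by apply/mnmP => i; apply/eqP; rewrite mnm0E -leqn0 -(mnm0E i) f0.
Qed.

(** The lcm lies in the lcm-lattice, so it is some [f c]; as [f] preserves and reflects order, [c]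
    is the least upper bound. *)
Lemma LCM_iso_join (k : fieldType) (d : Order.disp_t) (L : finTBLatticeType d)
    (n : nat) (I : {mpoly k[n]} -> Prop) (f : L -> 'X_{1..n}) :
  (forall a b, (f a <= f b)%MM = (a <= b)%O) ->
  (forall m, LCM I m <-> exists a, f a = m) ->
  forall a b, f (a `|` b)%O = mlcm (f a) (f b).
Proof.
move=> f_le f_im a b.
have fLCM c : LCM I (f c) by apply/f_im; exists c.
have [c fc] := (f_im _).1 (LCM_mlcm (fLCM a) (fLCM b)).
rewrite -fc; congr f; apply/le_anti/andP; split.
  by rewrite leUx -!f_le fc lem_mlcml lem_mlcmr.
by rewrite -f_le fc lem_mlcm !f_le leUl leUr.
Qed.

(** * Exponent vectors of the monomials x(a) and the lcm-lattice of the minimal ideal *)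

Definition xexp (d : Order.disp_t) (L : finTBLatticeType d) (a : L) :
    'X_{1..#|mi L|} :=
  [multinom (~~ (a <= enum_val i)%O : nat) | i < #|mi L|].

Lemma xmonE (k : fieldType) (d : Order.disp_t) (L : finTBLatticeType d) (a : L) :
  xmon k a = 'X_[xexp a].
Proof.
rewrite mpolyXE_id /xmon big_mkcond; apply: eq_bigr => i _.
by rewrite mnmE; case: (a <= _)%O.
Qed.

Lemma xexp_bot (d : Order.disp_t) (L : finTBLatticeType d) :
  xexp (\bot%O : L) = 0%MM.
Proof. by apply/mnmP => i; rewrite mnmE le0x mnm0E. Qed.

Lemma xexp_join (d : Order.disp_t) (L : finTBLatticeType d) (a b : L) :
  xexp (a `|` b)%O = mlcm (xexp a) (xexp b).
Proof. by apply/mnmP => i; rewrite !mnmE leUx; do 2!case: (_ <= _)%O. Qed.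

Lemma xexp_le (d : Order.disp_t) (L : finTBLatticeType d) (a b : L) :
  atomic L -> #|L| != 2%N -> (xexp a <= xexp b)%MM -> (a <= b)%O.
Proof.
move=> hL hL2 /mnm_lepP le_ab; apply/negPn/negP => nab.
have [l lmi /andP[le_bl nal]] := mi_separates hL hL2 nab.
by have := le_ab (enum_rank_in lmi l); rewrite !mnmE enum_rankK_in // le_bl nal.
Qed.

Lemma minimal_idealP (k : fieldType) (d : Order.disp_t)
    (L : finTBLatticeType d) p :
  @minimal_ideal k d L p <->
  ideal_gen (fun q => exists2 m, (exists2 a : L, atom a & m = xexp a) &
                        q = 'X_[m]) p.
Proof.
split; apply: ideal_gen_sub => q [].
  move=> a at_a ->; apply: mem_ideal_gen.
  by exists (xexp a); [exists a|rewrite xmonE].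
by move=> _ [a at_a ->] ->; apply: mem_ideal_gen; exists a; rewrite ?xmonE.
Qed.

(** A monomial of the ideal dividing x(b) is a multiple of some x(c) with [c] an atom; then c <= b,
    and two comparable atoms coincide. *)
Lemma min_generator_minimal_ideal (k : fieldType) (d : Order.disp_t)
    (L : finTBLatticeType d) (b : L) :
  atomic L -> #|L| != 2%N -> atom b ->
  min_generator (@minimal_ideal k d L) (xexp b).
Proof.
move=> hL hL2 at_b; split.
  by apply: mem_ideal_gen; exists b; rewrite ?xmonE.
move=> m /minimal_idealP/ideal_gen_mpolyX[_ [c at_c ->]] le_cm le_mb.
have le_cb := xexp_le hL hL2 (lepm_trans le_cm le_mb).
have cb : c = b.
  move: le_cb; rewrite le_eqVlt => /orP[/eqP//|lt_cb].
  have /andP[_ /forallP/(_ c)] := at_b; have /andP[-> _] := at_c.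
  by rewrite lt_cb.
rewrite {}cb in le_cm.
apply/mnmP => i; apply/eqP; rewrite eqn_leq.
by move/mnm_lepP: le_cm => ->; move/mnm_lepP: le_mb => ->.
Qed.

(** Joins become lcms under [xexp], and atomicity writes each element as a join of atoms, whose
    monomials are minimal generators. *)
Lemma LCM_minimal_ideal (k : fieldType) (d : Order.disp_t)
    (L : finTBLatticeType d) m :
  atomic L -> #|L| != 2%N ->
  LCM (@minimal_ideal k d L) m <-> exists a : L, xexp a = m.
Proof.
move=> hL hL2; split=> [[s [Ms ->]]|[a <-]].
  rewrite big_seq.
  apply: (big_ind (fun m => exists a : L, xexp a = m)).
  - by exists \bot%O; rewrite xexp_bot.
  - by move=> _ _ [a <-] [b <-]; exists (a `|` b)%O; rewrite xexp_join.
  - move=> g /Ms /(min_generator_of_gens (@minimal_idealP k d L))[a _ ->].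
    by exists a.
have [A [Aat ->]] := hL a.
apply: (big_ind (fun a : L => LCM (@minimal_ideal k d L) (xexp a))).
- by rewrite xexp_bot; apply: LCM0.
- by move=> x y Lx Ly; rewrite xexp_join; apply: LCM_mlcm.
- move=> b /Aat at_b; exists [:: xexp b].
  rewrite big_cons big_nil mlcm0; split=> // g.
  by rewrite inE => /eqP ->; apply: min_generator_minimal_ideal.
Qed.

Lemma atom_le (d : Order.disp_t) (L : finTBLatticeType d) (a : L) :
  atomic L -> a != \bot%O -> exists2 b, atom b & (b <= a)%O.
Proof.
move=> hL; have [A [Aat ->]] := hL a; case: (set_0Vmem A) => [->|[b Ab] _].
  by rewrite big_set0 eqxx.
by exists b; [apply: Aat|apply: joins_sup].
Qed.

(** * Algebra homomorphisms renaming variables *)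

Lemma lrmorphism_fix_vars (k : comNzRingType) (n : nat)
    (g : {lrmorphism {mpoly k[n]} -> {mpoly k[n]}}) :
  (forall i, g 'X_i = 'X_i) -> g =1 id.
Proof.
move=> gX p; rewrite {1}[p]mpolyE raddf_sum [RHS]mpolyE; apply: eq_bigr => m _.
rewrite /= linearZ /= mpolyXE_id rmorph_prod; congr (_ *: _).
apply: eq_bigr => i _.
by rewrite rmorphXn /= gX.
Qed.

Definition rename_vars (k : fieldType) (m n : nat) (h : 'I_m -> 'I_n) :
    {lrmorphism {mpoly k[m]} -> {mpoly k[n]}} :=
  comp_mpoly [tuple 'X_(h i) | i < m].

Lemma rename_varsU (k : fieldType) (m n : nat) (h : 'I_m -> 'I_n) i :
  rename_vars k h 'X_i = 'X_(h i).
Proof. by rewrite /= comp_mpolyXU -tnth_nth tnth_mktuple. Qed.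

Lemma rename_varsX (k : fieldType) (m n : nat) (h : 'I_m -> 'I_n) e :
  rename_vars k h 'X_[e] = 'X_[\sum_i U_(h i) *+ e i].
Proof.
rewrite /= comp_mpolyX (big_morph _ (@mpolyXD _ k) (@mpolyX0 _ k)).
apply: eq_bigr => i _.
by rewrite tnth_mktuple mpolyXn.
Qed.

Lemma rename_vars_inj (k : fieldType) (m n : nat) (h : 'I_m -> 'I_n) :
  injective h -> injective (rename_vars k h).
Proof.
move=> inj_h.
(* A left inverse only has to undo y_{h(i)}; all other variables are sent to 0. *)
pose back j : {mpoly k[m]} := if [pick i | h i == j] is Some i then 'X_i else 0.
pose r : {lrmorphism {mpoly k[n]} -> {mpoly k[m]}} :=
  comp_mpoly [tuple back j | j < n].
apply: (can_inj (g := r)).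
apply: (@lrmorphism_fix_vars _ _ (r \o rename_vars k h)) => i.
rewrite /= -/(rename_vars k h _) rename_varsU comp_mpolyXU -tnth_nth tnth_mktuple.
by rewrite /back; case: pickP => [i' /eqP/inj_h->//|/(_ i)]; rewrite eqxx.
Qed.

Lemma rename_varsK (k : fieldType) (m n : nat) (h : 'I_m -> 'I_n)
    (h' : 'I_n -> 'I_m) :
  cancel h h' -> cancel (rename_vars k h) (rename_vars k h').
Proof.
move=> hK.
apply: (@lrmorphism_fix_vars _ _ (rename_vars k h' \o rename_vars k h)) => i.
change (rename_vars k h' (rename_vars k h 'X_i) = 'X_i).
by rewrite !rename_varsU hK.
Qed.

Lemma rename_vars_bij (k : fieldType) (m n : nat) (h : 'I_m -> 'I_n) :
  bijective h -> bijective (rename_vars k h).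
Proof. by move=> [h' hK h'K]; exists (rename_vars k h'); apply: rename_varsK. Qed.

(** Injectivity keeps exponents from accumulating: coordinate [h i] of the sum is exactly [e i], and
    the others vanish. *)
Lemma mnm_rename_le (m n : nat) (h : 'I_m -> 'I_n) (e : 'X_{1..m})
    (e' : 'X_{1..n}) :
  injective h -> (forall i, e i <= e' (h i))%N ->
  (\sum_i U_(h i) *+ e i <= e')%MM.
Proof.
move=> inj_h le_e; apply/mnm_lepP => j; rewrite mnm_sumE.
case: (pickP (fun i => h i == j)) => [i /eqP <-|no].
  rewrite (bigD1 i) //= big1 ?addn0 => [|i' ne].
    by rewrite mulmnE mnm1E eqxx mul1n.
  by rewrite mulmnE mnm1E (inj_eq inj_h) (negPf ne).
by rewrite big1 // => i _; rewrite mulmnE mnm1E no.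
Qed.

(* The two guards only remove degenerate failures. For a one-element lattice
   the unit ideal also satisfies LCM_iso, while minimal_ideal k L = 0. For
   L = {0 < 1} the set mi L is empty, minimal_ideal k L is the unit ideal and
   its lcm-lattice is not isomorphic to L. *)
Theorem theorem2p8 (k : fieldType) (d : Order.disp_t) (L : finTBLatticeType d)
    (n : nat) (I : {mpoly k[n]} -> Prop)
    (hL : atomic L)
    (hI : squarefree_monomial_ideal I)
    (hLI : LCM_iso L I) :
  [/\ (#|mi L| <= n)%N,
      ~ I 1 ->
      exists phi : {lrmorphism {mpoly k[#|mi L|]} -> {mpoly k[n]}},
        [/\ injective phi,
            forall i : 'I_#|mi L|, exists j : 'I_n, phi 'X_i = 'X_j,
            forall p, I p ->
              ideal_gen (fun q => exists2 r, minimal_ideal r & q = phi r) p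
          & n = #|mi L| -> bijective phi]
    & #|L| != 2%N ->
      exists rho : {set 'I_#|mi L|} -> {set 'I_n},
        [/\ injective rho,
            {morph rho : A B / A :|: B}
          & forall B : {set 'I_n},
              (exists2 m, LCM (@minimal_ideal k d L) m & B = rho (mnm_support m))
              <-> (exists2 m, LCM I m & B = mnm_support m)]].
Proof.
have [f [f_le f_im]] := hLI.
have f0 := LCM_iso_bot f_le f_im; have fU := LCM_iso_join f_le f_im.
have sqf a : squarefree (f a) by apply: (LCM_squarefree hI); apply/f_im; exists a.
pose mu := last_missing f.
have le_mu a j : (a <= mu j)%O = (f a j == 0%N) by apply: le_last_missing.
have /fin_all_exists[jm jmE] (i : 'I_#|mi L|) : exists j, mu j = enum_val i.
  exact: (mi_last_missing f_le f0 fU sqf (enum_valP i)).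
have inj_jm : injective jm.
  by move=> i i' eq_j; apply: enum_val_inj; rewrite -!jmE eq_j.
split.
- by have := leq_card jm inj_jm; rewrite !card_ord.
- move=> nI1; exists (rename_vars k jm); split.
  + exact: rename_vars_inj.
  + by move=> i; exists (jm i); apply: rename_varsU.
  + have [G [_ IG]] := hI; move=> p /IG; apply: ideal_gen_sub => _ [g Gg ->].
    have : I 'X_[g] by apply/IG/mem_ideal_gen; exists g.
    move=> /min_generator_le[g' min_g' le_g'g].
    have [a fa] : exists a, f a = g'.
      apply/f_im; exists [:: g']; rewrite big_cons big_nil mlcm0; split=> // e.
      by rewrite inE => /eqP ->.
    (* Otherwise the minimal generator would be 1, making [I] the unit ideal. *)
    have a0 : a != \bot%O.
      apply: contra_notN nI1 => /eqP a0; have [+ _] := min_g'.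
      by rewrite -fa a0 f0 mpolyX0.
    have [b at_b le_ba] := atom_le hL a0.
    have le_phi : (\sum_i U_(jm i) *+ xexp b i <= g)%MM.
      apply: lepm_trans le_g'g; rewrite -fa.
      apply: lepm_trans (_ : (f b <= f a)%MM); last by rewrite f_le.
      apply: mnm_rename_le => // i.
      by rewrite mnmE -jmE le_mu; case: (f b (jm i)).
    rewrite -(submK le_phi) mpolyXD -rename_varsX.
    apply/ideal_genMl/mem_ideal_gen; exists 'X_[xexp b] => //.
    by apply: mem_ideal_gen; exists b; rewrite ?xmonE.
  + by move=> eq_n; apply/rename_vars_bij/inj_card_bij; rewrite // !card_ord eq_n.
move=> hL2.
(* A variable labelled by a meet-irreducible [l] is put in [rho A] only when [l]
   itself is in [A]: allowing every [l' \in A] above [l] would still map [L] onto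
   [LCM I], but injectivity would fail as soon as [mi L] has two comparable
   elements. *)
pose rho (A : {set 'I_#|mi L|}) := [set j | [exists i in A,
  (enum_val i == mu j) || (mu j \notin mi L) && (mu j <= enum_val i)%O]].
(* The label of [jm i] is meet-irreducible, so only the equality clause applies; [A] is thus
   recovered as the preimage of [rho A] under [jm]. *)
have rho_jm A i : (jm i \in rho A) = (i \in A).
  rewrite inE; apply/exists_inP/idP => [[i' Ai']|Ai]; last first.
    by exists i; rewrite // jmE eqxx.
  by rewrite jmE enum_valP orbF => /eqP/enum_val_inj <-.
have rhoE a : rho (mnm_support (xexp a)) = mnm_support (f a).
  apply/setP => j; rewrite [LHS]inE [RHS]inE -le_mu.
  apply/exists_inP/idP => [[i]|].
    rewrite inE mnmE eqb0 negbK => nai mu_i.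
    apply: contra nai => /le_trans; apply.
    by case/orP: mu_i => [/eqP->|/andP[]].
  (* A meet-irreducible label is its own witness; any other label is replaced by a meet-irreducible
     above it that separates it from [a]. *)
  have [mi_mu|_] := boolP (mu j \in mi L) => naj.
    exists (enum_rank_in mi_mu (mu j)); last by rewrite enum_rankK_in ?eqxx.
    by rewrite inE mnmE enum_rankK_in // naj.
  have [l lmi /andP[le_l nal]] := mi_separates hL hL2 naj.
  exists (enum_rank_in lmi l); first by rewrite inE mnmE enum_rankK_in // nal.
  by rewrite orbC enum_rankK_in // le_l.
exists rho; split.
- by move=> A B eqAB; apply/setP => i; rewrite -!rho_jm eqAB.
- move=> A B; apply/setP => j; rewrite !inE; apply/exists_inP/orP => [[i]|].
    by rewrite inE => /orP[] iA Pi; [left|right]; apply/exists_inP; exists i.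
  by case=> /exists_inP[i iA Pi]; exists i; rewrite // inE iA ?orbT.
- move=> B; split=> [[_ /(LCM_minimal_ideal k _ hL hL2)[a <-] ->]|].
    by exists (f a) => //; apply/f_im; exists a.
  move=> [_ /f_im[a <-] ->]; exists (xexp a); last by rewrite rhoE.
  by apply/LCM_minimal_ideal => //; exists a.
Qed.
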